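(* Let $R$ be an associative ring with unit and let $I$ be an idempotent two-sided ideal of $R$. If $I$ is the trace of a projective left (resp. right) $R$-module, then $R/I$ is a silting left (resp. right) $R$-module.
   Context: Idempotent means $I^2=I$. The trace of a left $R$-module $P$ is $\mathrm{Tr}(P)=\sum_{f\in \mathrm{Hom}_R(P,R)}\mathrm{Im}(f)$, a two-sided ideal of $R$ (similarly for right modules). The projective module $P$ is not assumed finitely generated. For a morphism $\sigma$ of left $R$-modules put $\mathcal{D}_\sigma=\{X\in R\text{-}\mathrm{Mod} : \mathrm{Hom}_R(\sigma,X)\text{ is surjective}\}$. For a module $S$, $\mathrm{Gen}(S)$ is the class of modules $M$ admitting an epimorphism $S^{(\alpha)}\to M$ for some set $\alpha$, where $S^{(\alpha)}$ is the coproduct of $\alpha$ copies of $S$. A module $S$ is silting if there is a morphism $\sigma:P_{-1}\to P_0$ between projective modules with $S\cong\mathrm{Coker}(\sigma)$ and $\mathcal{D}_\sigma=\mathrm{Gen}(S)$. The same definitions apply to right modules. *)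

(* Defs.v *)
From HB Require Import structures.
From mathcomp Require Import all_boot all_algebra generic_quotient.
From mathcomp Require Import boolp classical_sets functions cardinality.

Set Implicit Arguments.
Unset Strict Implicit.
Unset Printing Implicit Defensive.

Import GRing.Theory ring_quotient.Quotient.

Local Open Scope ring_scope.
Local Open Scope quotient_scope.
Local Open Scope classical_set_scope.

(* Left R-modules are [lmodType R] and right R-modules are [lmodType R^c]; the
   module R is [R^o], resp. [(R^c)^o].  Rings are [pzRingType]s, so that the
   zero ring is allowed. *)

(* M / N for a submodule N of M.  The library makes [{quot N}] a Z-module only,
   for a predicate N that carries its closure properties canonically. *)
Section ModuleQuotient.
Variables (R : pzRingType) (M : lmodType R) (N : {pred M}).
Variable clN : submod_closed N.

Definition submod_pred of submod_closed N : {pred M} := N.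

HB.instance Definition _ := GRing.isSubmodClosed.Build R M (submod_pred clN)
  clN.

Definition quotmod_type : Type := {quot (submod_pred clN)}.

HB.instance Definition _ := GRing.Zmodule.on quotmod_type.

Definition quotmod_pi (x : M) : quotmod_type := \pi_{quot (submod_pred clN)} x.

Definition quotmod_scale (a : R) (x : quotmod_type) : quotmod_type :=
  quotmod_pi (a *: repr x).

Lemma quotmod_reprK (x : quotmod_type) : quotmod_pi (repr x) = x.
Proof. exact: reprK. Qed.

Lemma quotmod_piP (x y : M) :
  reflect (quotmod_pi x = quotmod_pi y) (x - y \in N).
Proof.
have := idealrBE (submod_pred clN) x y; rewrite {1}/submod_pred => ->.
exact: eqP.
Qed.

Lemma quotmod_piD : {morph quotmod_pi : x y / x + y}.
Proof. exact: raddfD. Qed.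

Lemma quotmod_piZ (a : R) (x : M) :
  quotmod_scale a (quotmod_pi x) = quotmod_pi (a *: x).
Proof.
apply/quotmod_piP; rewrite -scalerBr -[N]/(submod_pred clN : {pred M}) rpredZ//.
by apply/quotmod_piP; rewrite quotmod_reprK.
Qed.

Lemma quotmod_scaleA (a b : R) (x : quotmod_type) :
  quotmod_scale a (quotmod_scale b x) = quotmod_scale (a * b) x.
Proof. by rewrite -[x]quotmod_reprK !quotmod_piZ scalerA. Qed.

Lemma quotmod_scale1 : left_id 1 quotmod_scale.
Proof. by move=> x; rewrite -[x]quotmod_reprK quotmod_piZ scale1r. Qed.

Lemma quotmod_scaleDr : right_distributive quotmod_scale +%R.
Proof.
move=> a x y; rewrite -[x]quotmod_reprK -[y]quotmod_reprK.
by rewrite -quotmod_piD !quotmod_piZ -quotmod_piD scalerDr.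
Qed.

Lemma quotmod_scaleDl (x : quotmod_type) :
  {morph quotmod_scale^~ x : a b / a + b}.
Proof.
by move=> a b /=; rewrite -[x]quotmod_reprK !quotmod_piZ -quotmod_piD scalerDl.
Qed.

HB.instance Definition _ := GRing.Zmodule_isLmodule.Build R quotmod_type
  quotmod_scaleA quotmod_scale1 quotmod_scaleDr quotmod_scaleDl.

Definition quotmod : lmodType R := quotmod_type.

End ModuleQuotient.

Section Cokernel.
Variables (R : pzRingType) (M N : lmodType R) (s : {linear M -> N}).

Definition im_pred : {pred N} := fun y => `[< range s y >].

Lemma im_pred_submod_closed : submod_closed im_pred.
Proof.
split; first by apply/asboolP; exists 0; rewrite ?linear0.
move=> a _ _ /asboolP[x _ <-] /asboolP[y _ <-].
by apply/asboolP; exists (a *: x + y); rewrite ?linearP.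
Qed.

Definition coker : lmodType R := quotmod im_pred_submod_closed.

End Cokernel.

(* S^(A): the finitely supported functions from A to S. *)
Section Coproduct.
Variables (R : pzRingType) (A : Type) (S : lmodType R).

Definition finsupp_pred : {pred A -> S} :=
  fun f => `[< finite_set [set a | f a <> 0] >].

Lemma finsupp_pred_submod_closed : submod_closed finsupp_pred.
Proof.
split.
  apply/asboolP; apply: (sub_finite_set _ (finite_set0 A)).
  by move=> a /= /(_ erefl).
move=> k f g /asboolP hf /asboolP hg; apply/asboolP.
have hfg : finite_set ([set a | f a <> 0] `|` [set a | g a <> 0]).
  by rewrite finite_setU.
apply: (sub_finite_set _ hfg) => a /= h; apply: contrapT => /not_orP[].
move=> /contrapT f0 /contrapT g0; apply: h.
have -> : (k *: f + g) a = k *: f a + g a by [].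
by rewrite f0 g0 scaler0 add0r.
Qed.

HB.instance Definition _ := GRing.isSubmodClosed.Build R (A -> S)
  finsupp_pred finsupp_pred_submod_closed.

Definition coprod_type : Type := {f : A -> S | f \in finsupp_pred}.

HB.instance Definition _ := SubChoice.on coprod_type.
HB.instance Definition _ := [SubChoice_isSubLmodule of coprod_type by <:].

Definition coprod : lmodType R := coprod_type.

End Coproduct.

Section Silting.
Variable R : pzRingType.

Definition projective (P : lmodType R) : Prop :=
  forall (M N : lmodType R) (g : {linear M -> N}) (f : {linear P -> N}),
    range g = [set: N] -> exists h : {linear P -> M}, forall p, g (h p) = f p.

Definition isomorphic (M N : lmodType R) : Prop :=
  exists f : {linear M -> N}, bijective f.

(* X belongs to the class D_s: Hom_R(s, X), i.e. composition with s, is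
   surjective. *)
Definition inD (P1 P0 : lmodType R) (s : {linear P1 -> P0})
    (X : lmodType R) : Prop :=
  forall g : {linear P1 -> X}, exists h : {linear P0 -> X},
    forall p, h (s p) = g p.

Definition inGen (S M : lmodType R) : Prop :=
  exists (A : Type) (e : {linear coprod A S -> M}), range e = [set: M].

Definition silting (S : lmodType R) : Prop :=
  exists (P1 P0 : lmodType R) (s : {linear P1 -> P0}),
    [/\ projective P1, projective P0, isomorphic S (coker s)
      & forall X : lmodType R, inD s X <-> inGen S X].

(* The sum of the images of the homomorphisms P -> R, i.e. the set of finite
   sums of elements of these images. *)
Definition trace (P : lmodType R) : set R :=
  [set r | exists (n : nat) (f : 'I_n -> {linear P -> R^o}) (p : 'I_n -> P),
             r = \sum_(i < n) f i (p i)].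

End Silting.

(* Two-sided ideals, possibly equal to R. *)
Record ideal (R : pzRingType) := Ideal {
  ideal_set :> set R;
  ideal0 : ideal_set 0;
  idealD : forall x y, ideal_set x -> ideal_set y -> ideal_set (x + y);
  idealMl : forall a x, ideal_set x -> ideal_set (a * x);
  idealMr : forall a x, ideal_set x -> ideal_set (x * a)
}.

Definition ideal_mul (R : pzRingType) (I J : ideal R) : set R :=
  [set r | exists (n : nat) (a b : 'I_n -> R),
     [/\ forall i, ideal_set I (a i), forall i, ideal_set J (b i)
      & r = \sum_(i < n) a i * b i]].

Definition idempotent_ideal (R : pzRingType) (I : ideal R) : Prop :=
  ideal_mul I I = I.

Definition converse_ideal (R : pzRingType) (I : ideal R) : ideal R^c :=
  @Ideal R^c (I : set R) (ideal0 I) (@idealD R I)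
    (@idealMr R I) (@idealMl R I).

Section QuotientByIdeal.
Variables (R : pzRingType) (I : ideal R).

Definition ideal_pred : {pred R^o} := fun x => `[< ideal_set I x >].

Lemma ideal_pred_submod_closed : submod_closed ideal_pred.
Proof.
split; first by apply/asboolP; exact: ideal0.
move=> a x y /asboolP Ix /asboolP Iy; apply/asboolP.
by apply: idealD => //; exact: idealMl.
Qed.

Definition left_quot : lmodType R := quotmod ideal_pred_submod_closed.

End QuotientByIdeal.

Definition right_quot (R : pzRingType) (I : ideal R) : lmodType R^c :=
  left_quot (converse_ideal I).

(* Main.v *)
Require Import Defs.
From HB Require Import structures.
From mathcomp Require Import all_boot all_algebra.
From mathcomp Require Import boolp classical_sets cardinality fsbigop.

Import GRing.Theory.

Local Open Scope ring_scope.

(** The trace [I] of a projective module [P] is presented by the map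
    [s : P^(Hom(P, R)) -> R] whose component of index [f] is [f] itself: its
    image is the sum of the images of all [f], so its cokernel is [R/I].  Both
    [Gen(R/I)] and [D_s] are the class of the modules [X] with [I X = 0].

    For [Gen(R/I)] this is the fact that such an [X] is an [R/I]-module, hence
    a quotient of a free one ([inGen_left_quotP]).

    If [X] is in [D_s], extend an arbitrary [g : P -> X] by zero from the
    component of index [0] to [P^(Hom(P, R))].  The extension factors through
    [s], and [s] vanishes on that component, so [g = 0].  Thus [Hom(P, X) = 0];
    applied to the maps [p |-> f p *: x], this says that [I X = 0]
    ([trace_annihilates]).

    Conversely, let [I X = 0] and let [g : P -> X].  Since [P] is projective,
    [g] lifts along the epimorphism [R^(X) -> X] to a map whose components are
    homomorphisms [P -> R]; their values lie in [I], which kills [X], so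
    [g = 0] ([projective_hom_annihilated]).  Hence [Hom(P^(Hom(P, R)), X) = 0]
    and the factorization that defines [D_s] is trivial. *)

Set Implicit Arguments.
Unset Strict Implicit.
Unset Printing Implicit Defensive.

(** * Linear maps out of R, out of quotients and out of coproducts *)

Section ScaleMap.
Variables (R : pzRingType) (X : lmodType R) (x : X).

Definition scale_at (r : R^o) : X := (r : R) *: x.

Lemma scale_at_linear : linear scale_at.
Proof. by move=> a r r'; rewrite /scale_at scalerDl scalerA. Qed.

HB.instance Definition _ :=
  GRing.isLinear.Build R R^o X *:%R scale_at scale_at_linear.

End ScaleMap.

Lemma projective_regular (R : pzRingType) : projective (R^o : lmodType R).
Proof.
move=> M N g f gT.
have [m _ gm] : range g (f 1) by rewrite gT.
exists (scale_at m : {linear R^o -> M}) => r.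
by rewrite /= /scale_at linearZ gm -linearZ /=; congr (f _); exact: mulr1.
Qed.

Lemma quotmod_lift (R : pzRingType) (M X : lmodType R) (N : {pred M})
    (clN : submod_closed N) (f : {linear M -> X}) :
  (forall y, y \in N -> f y = 0) ->
  exists h : {linear quotmod clN -> X}, forall y, h (quotmod_pi clN y) = f y.
Proof.
move=> fN.
(* [f] is constant on cosets, so it may be computed on a representative. *)
pose h (u : quotmod clN) : X := f (repr (u : quotmod_type clN)).
have h_pi y : h (quotmod_pi clN y) = f y.
  apply/eqP; rewrite -subr_eq0 -linearB fN //.
  by apply/(quotmod_piP clN); rewrite quotmod_reprK.
have h_linear : linear h.
  move=> a u v; rewrite -[u](quotmod_reprK (clN := clN)).
  rewrite -[v](quotmod_reprK (clN := clN)).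
  set x := repr _; set y := repr _.
  have -> : a *: (quotmod_pi clN x : quotmod clN) + quotmod_pi clN y
          = quotmod_pi clN (a *: x + y).
    by rewrite quotmod_piD -quotmod_piZ.
  by rewrite !h_pi linearP.
pose hL := GRing.isLinear.Build R (quotmod clN) X *:%R h h_linear.
by exists (HB.pack_for {linear quotmod clN -> X} h hL).
Qed.

Section Coproduct.
Variables (R : pzRingType) (A : choiceType) (S : lmodType R).

Definition coprod_proj (a : A) (u : coprod A S) : S := \val u a.

Lemma coprod_proj_linear a : linear (coprod_proj a).
Proof. by move=> k u v; rewrite /coprod_proj linearP. Qed.

HB.instance Definition _ a := GRing.isLinear.Build R (coprod A S) S *:%R
  (coprod_proj a) (coprod_proj_linear a).

Lemma coprod_eqP (u v : coprod A S) :
  (forall a, coprod_proj a u = coprod_proj a v) -> u = v.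
Proof. by move=> uv; apply/val_inj/funext. Qed.

Lemma coprod_support (u : coprod A S) :
  exists2 s : seq A, uniq s & forall a, a \notin s -> coprod_proj a u = 0.
Proof.
have /asboolP/finite_seqP[s us] := valP u.
exists (undup s); first exact: undup_uniq.
move=> a; rewrite mem_undup => /negP; apply: contra_notP => ua.
by have : [set b | \val u b <> 0]%classic a by []; rewrite us.
Qed.

Lemma coprod_inj_subproof (a : A) (p : S) :
  (fun b => if b == a then p else 0) \in @finsupp_pred R A S.
Proof.
apply/asboolP; apply: (sub_finite_set _ (finite_set1 a)) => b /=.
by case: eqP.
Qed.

Definition coprod_inj (a : A) (p : S) : coprod A S :=
  exist (fun f : A -> S => f \in @finsupp_pred R A S) _
    (coprod_inj_subproof a p).

Lemma coprod_injE a p b :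
  coprod_proj b (coprod_inj a p) = if b == a then p else 0.
Proof. by []. Qed.

Lemma coprod_inj_linear a : linear (coprod_inj a).
Proof.
move=> k p q; apply: coprod_eqP => b; rewrite linearP /= !coprod_injE.
by case: eqP => // _; rewrite scaler0 addr0.
Qed.

HB.instance Definition _ a := GRing.isLinear.Build R S (coprod A S) *:%R
  (coprod_inj a) (coprod_inj_linear a).

Lemma coprod_sum_inj (s : seq A) (u : coprod A S) : uniq s ->
  (forall a, a \notin s -> coprod_proj a u = 0) ->
  u = \sum_(a <- s) coprod_inj a (coprod_proj a u).
Proof.
move=> s_uniq us; apply: coprod_eqP => b; rewrite linear_sum /=.
under eq_bigr do rewrite coprod_injE.
have [bs|/[dup] /us -> bs] := boolP (b \in s); last first.
  by rewrite big1_seq // => a /= aS; case: eqP => // ba; rewrite ba aS in bs.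
rewrite (bigD1_seq b) //= eqxx big1 ?addr0 // => a.
by rewrite eq_sym => /negPf ->.
Qed.

Lemma coprod_hom_eq (X : lmodType R) (f g : {linear coprod A S -> X}) :
  (forall a p, f (coprod_inj a p) = g (coprod_inj a p)) -> f =1 g.
Proof.
move=> fg u; have [s s_uniq us] := coprod_support u.
by rewrite (coprod_sum_inj s_uniq us) !linear_sum; apply: eq_bigr.
Qed.

Section Lift.
Variables (X : lmodType R) (g : A -> {linear S -> X}).

(** The sum over [[set: A]] is zero on families of infinite support; here the
    support is finite, and [coprod_liftE] computes the sum on any list that
    contains it. *)
Definition coprod_lift (u : coprod A S) : X :=
  \sum_(a \in [set: A]) g a (coprod_proj a u).

Lemma coprod_liftE (s : seq A) (u : coprod A S) : uniq s ->
  (forall a, a \notin s -> coprod_proj a u = 0) ->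
  coprod_lift u = \sum_(a <- s) g a (coprod_proj a u).
Proof.
move=> s_uniq us; rewrite /coprod_lift (fsbigE s) //.
  by apply: eq_bigl => a; rewrite in_setT.
by move=> a _ /us ->; rewrite linear0.
Qed.

Lemma coprod_lift_linear : linear coprod_lift.
Proof.
move=> k u v.
(* Additivity is checked on a common list of indices for [u] and [v]. *)
have [s _ us] := coprod_support u; have [t _ vt] := coprod_support v.
have st a : a \notin undup (s ++ t) ->
    coprod_proj a u = 0 /\ coprod_proj a v = 0.
  by rewrite mem_undup mem_cat => /norP[/us -> /vt ->].
rewrite !(@coprod_liftE (undup (s ++ t))) ?undup_uniq //; first last.
- by move=> a /st[ua va]; rewrite linearP /= ua va scaler0 addr0.
- by move=> a /st[].
- by move=> a /st[].
rewrite scaler_sumr -big_split; apply: eq_bigr => a _.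
by rewrite !linearP.
Qed.

HB.instance Definition _ := GRing.isLinear.Build R (coprod A S) X *:%R
  coprod_lift coprod_lift_linear.

Lemma coprod_lift_inj a p : coprod_lift (coprod_inj a p) = g a p.
Proof.
rewrite (@coprod_liftE [:: a]) //.
  by rewrite big_seq1 coprod_injE eqxx.
by move=> b; rewrite inE coprod_injE => /negPf ->.
Qed.

End Lift.

Lemma projective_coprod : projective S -> projective (coprod A S).
Proof.
move=> projS M N g f gT.
have /choice[h hP] a : exists h : {linear S -> M},
    forall p, g (h p) = f (coprod_inj a p).
  exact: (projS M N g (f \o coprod_inj a) gT).
exists (coprod_lift h) => u.
rewrite -[LHS]/((g \o coprod_lift h) u); move: u.
apply: coprod_hom_eq => a p /=.
by rewrite coprod_lift_inj.
Qed.

End Coproduct.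

(** * Modules annihilated by an ideal *)

Section Annihilated.
Variables (R : pzRingType) (I : ideal R).

Definition annihilated (X : lmodType R) : Prop :=
  forall r (x : X), ideal_set I r -> r *: x = 0.

Lemma left_quot_annihilated : annihilated (left_quot I).
Proof.
move=> r x Ir; rewrite -[x](quotmod_reprK (clN := ideal_pred_submod_closed I)).
set y := repr _.
have -> : r *: (quotmod_pi _ y : left_quot I)
    = quotmod_pi (ideal_pred_submod_closed I) (r *: y) by exact: quotmod_piZ.
have -> : 0 = quotmod_pi (ideal_pred_submod_closed I) 0.
  by apply/esym; exact: raddf0.
apply/quotmod_piP; rewrite subr0; apply/asboolP.
exact: Defs.idealMr.
Qed.

Lemma inGen_left_quotP (X : lmodType R) :
  inGen (left_quot I) X <-> annihilated X.
Proof.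
split=> [[A [e eT]] r x Ir|IX].
  have [u _ <-] : range e x by rewrite eT.
  rewrite -linearZ; suff -> : r *: u = 0 by rewrite linear0.
  by apply/val_inj/funext => a; exact: left_quot_annihilated.
(* The map [R/I^(X) -> X] whose component of index [x] sends the class of [r]
   to [r *: x] is onto. *)
have /choice[g gE] (x : X) : exists g : {linear left_quot I -> X},
    forall r : R, g (quotmod_pi _ (r : R^o)) = r *: x.
  by apply: (@quotmod_lift _ _ _ _ _ (scale_at x)) => r /asboolP Ir; exact: IX.
exists X, (coprod_lift g : {linear _ -> _}); apply/seteqP; split=> // x _.
exists (coprod_inj x (quotmod_pi (ideal_pred_submod_closed I) 1)) => //.
by rewrite /= coprod_lift_inj gE scale1r.
Qed.

(** A form of [P = trace P * P]: the lift of [g] along [R^(X) -> X] writes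
    [g p] as a combination of elements of [X] with coefficients in the trace. *)
Lemma projective_hom_annihilated (P X : lmodType R) (g : {linear P -> X}) :
  projective P -> (trace P `<=` I)%classic -> annihilated X ->
  forall p, g p = 0.
Proof.
move=> projP trP IX p.
pose e : {linear coprod X R^o -> X} := coprod_lift (@scale_at R X).
have eT : range e = setT.
  apply/seteqP; split=> // x _; exists (coprod_inj (S := R^o) x 1) => //.
  by rewrite /e /= coprod_lift_inj; exact: scale1r.
have [h <-] := projP _ _ e g eT.
have [s s_uniq hs] := coprod_support (h p).
rewrite /e /= (coprod_liftE _ s_uniq hs) big1 // => x _.
apply: IX; apply: trP.
exists 1%N, (fun=> coprod_proj x \o h), (fun=> p).
by rewrite big_ord_recl big_ord0 addr0.
Qed.

Lemma trace_annihilates (P X : lmodType R) :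
  (I `<=` trace P)%classic ->
  (forall (g : {linear P -> X}) p, g p = 0) -> annihilated X.
Proof.
move=> trP PX r x /trP[n [f [p ->]]]; rewrite scaler_suml big1 // => i _.
exact: (PX (scale_at x \o f i)).
Qed.

End Annihilated.

(** * The presentation of R / trace P *)

Section TracePresentation.
Variables (R : pzRingType) (P : lmodType R).

(** All homomorphisms [P -> R], the zero one included; the classical choice
    structure is what sums over arbitrary supports require of their indices. *)
Definition trace_index : choiceType := {classic {linear P -> R^o}}.

Definition trace_index0 : trace_index := (\0 : {linear P -> R^o}).

Definition trace_map : {linear coprod trace_index P -> R^o} :=
  coprod_lift (fun f : trace_index => f : {linear P -> R^o}).

Lemma range_trace_map : range trace_map = trace P.
Proof.
apply/seteqP; split=> [_ [u _ <-]|_ [n [f [p ->]]]].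
  have [s s_uniq us] := coprod_support u.
  rewrite /trace_map /= (coprod_liftE _ s_uniq us).
  rewrite (big_nth trace_index0) big_mkord.
  by exists (size s), (fun i => nth trace_index0 s i),
    (fun i => coprod_proj (nth trace_index0 s i) u).
exists (\sum_(i < n) coprod_inj (f i : trace_index) (p i)) => //.
by rewrite linear_sum; apply: eq_bigr => i _; rewrite /= coprod_lift_inj.
Qed.

(** The index [trace_index0] makes [trace_map] vanish on a whole copy of [P], so
    that a map which factors through [trace_map] is zero on this copy. *)
Lemma inD_trace_map_hom0 (X : lmodType R) (g : {linear P -> X}) :
  inD trace_map X -> forall p, g p = 0.
Proof.
move=> /(_ (g \o coprod_proj trace_index0))[h hP] p.
have /= := hP (coprod_inj trace_index0 p).
by rewrite coprod_lift_inj linear0 coprod_injE eqxx.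
Qed.

End TracePresentation.

Lemma silting_left_quot_trace (R : pzRingType) (I : ideal R) (P : lmodType R) :
  projective P -> trace P = I :> set R -> silting (left_quot I).
Proof.
move=> projP trP; exists (coprod (trace_index P) P), R^o, (trace_map P).
(* Both quotients are by the same subset of [R], so they are equal and the
   isomorphism is the identity. *)
have cokerE : coker (trace_map P) = left_quot I.
  rewrite /coker /left_quot.
  move: (im_pred_submod_closed _) (ideal_pred_submod_closed I).
  have -> : im_pred (trace_map P) = ideal_pred I.
    by apply/funext => r; rewrite /im_pred range_trace_map trP.
  by move=> c d; rewrite (Prop_irrelevance c d).
split; [exact: projective_coprod | exact: projective_regular | |].
  by rewrite cokerE; exists idfun; exists id.
move=> X; rewrite inGen_left_quotP; split=> [sX|IX g].
  apply: (@trace_annihilates _ _ P); first by rewrite trP.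
  by move=> g; exact: inD_trace_map_hom0.
have g0 : g =1 (\0 : {linear _ -> X}).
  apply: coprod_hom_eq => f p.
  apply: (@projective_hom_annihilated _ I _ _ (g \o coprod_inj f)) => //.
  by rewrite trP.
by exists \0 => u; rewrite g0.
Qed.

Theorem theoremA (R : pzRingType) (I : ideal R) (I2 : idempotent_ideal I) :
  ((exists P : lmodType R, projective P /\ trace P = I :> set R) ->
     silting (left_quot I)) /\
  ((exists P : lmodType R^c, projective P /\ trace P = I :> set R) ->
     silting (right_quot I)).
Proof.
split=> -[P [projP trP]]; first exact: (silting_left_quot_trace projP).
by apply: (@silting_left_quot_trace _ (converse_ideal I) P).
Qed.
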